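(* Let $k\ge1$ and $(\alpha_1,\dots,\alpha_k)\in(0,\pi)^k$. For every large $n$ there is a set $E$ of $\approx n$ points in $\mathbb{R}^2$ such that the number of tuples $(x_1,\dots,x_{k+2})$ with $x_1=0$ (the origin), $x_2,\dots,x_{k+2}\in E$, and $\angle(x_j,x_{j+1},x_{j+2})=\alpha_j$ for all $1\le j\le k$, is $\gtrsim n^{\lfloor k/2\rfloor+1}$.
   Context: $\angle(x,y,z)\in[0,\pi]$ denotes the angle at $y$ between $x-y$ and $z-y$ (for $x\ne y\ne z$). $X(n)\lesssim Y(n)$ means $X(n)\le CY(n)$ for all $n>N$ with constants $C,N$ independent of $n$ (possibly depending on $k$ and the angles); $\gtrsim$ is the reverse relation, $\approx$ means both. *)

(* Defs.v *)
From mathcomp Require Import all_boot all_order all_algebra finmap.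
From mathcomp Require Import all_classical all_reals all_analysis.

Set Implicit Arguments.
Unset Strict Implicit.
Unset Printing Implicit Defensive.

Import Order.TTheory GRing.Theory Num.Theory.

Local Open Scope classical_set_scope.
Local Open Scope ring_scope.

(* The library norm `|u| on 'rV[R]_2 is the sup norm, so the Euclidean
   structure of the plane is introduced here. *)
Definition dot (R : realType) (u v : 'rV[R]_2) : R := \sum_i u 0 i * v 0 i.

Definition enorm (R : realType) (u : 'rV[R]_2) : R := Num.sqrt (dot u u).

(* Meaningful only for x != y and y != z; when x = y or y = z the quotient
   is 0 and the value is the junk value pi / 2, so users of [angle] must
   require nondegeneracy separately. *)
Definition angle (R : realType) (x y z : 'rV[R]_2) : R :=
  acos (dot (x - y) (z - y) / (enorm (x - y) * enorm (z - y))).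

(* The tuple (x_1, ..., x_{k+2}) is indexed from 0: x_j is x`_(j-1).  All
   indices below are in range, so the default value of nth is never used. *)
Definition angle_chains (R : realType) (k : nat) (alpha : 'I_k -> R)
    (E : {fset 'rV[R]_2}) : set (k.+2.-tuple 'rV[R]_2) :=
  [set x : k.+2.-tuple 'rV[R]_2 |
           [/\ x`_0 = 0,
               forall i : nat, (1 <= i < k.+2)%N -> x`_i \in E &
               forall j : 'I_k,
                 [/\ x`_j != x`_j.+1, x`_j.+1 != x`_j.+2 &
                     angle x`_j x`_j.+1 x`_j.+2 = alpha j]]].

(* [angle_chains alpha E] is finite because E is, so this is its true
   cardinality. *)
Definition num_angle_chains (R : realType) (k : nat) (alpha : 'I_k -> R)
    (E : {fset 'rV[R]_2}) : nat :=
  #|` fset_set (angle_chains alpha E)|.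

Definition asymp_le (R : realType) (X Y : nat -> R) : Prop :=
  exists C : R, exists N : nat,
    0 < C /\ forall n : nat, (N < n)%N -> X n <= C * Y n.

Definition asymp_ge (R : realType) (X Y : nat -> R) : Prop := asymp_le Y X.

Definition asymp_eq (R : realType) (X Y : nat -> R) : Prop :=
  asymp_le X Y /\ asymp_ge X Y.

(* Main.v *)
(* A polygonal path whose i-th edge has direction d_i, where d_(i+1) is d_i
   turned by pi - alpha_i, realizes the prescribed angles whatever its edge
   lengths. Fix these directions and lines l_0, l_1, ... with l_j parallel to
   d_(2j). Counting vertices from x_0 = 0, the vertex x_(2j+1) runs freely over
   n points of l_j, and x_(2j+2) is its projection to l_(j+1) in direction
   d_(2j+1). Spacing the lines and points far enough makes all edge lengths
   positive. Among the vertices x_1, ..., x_(k+1) there are floor(k/2) + 1 free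
   ones, while each of them takes at most n values. *)

Require Import Defs.
From mathcomp Require Import all_boot all_order all_algebra finmap.
From mathcomp Require Import all_classical all_reals all_analysis.
From mathcomp Require Import ring lra.

Set Implicit Arguments.
Unset Strict Implicit.
Unset Printing Implicit Defensive.

Import Order.TTheory GRing.Theory Num.Theory.

Local Open Scope ring_scope.

Lemma dotZl (R : realType) (a : R) (u v : 'rV[R]_2) :
  dot (a *: u) v = a * dot u v.
Proof.
by rewrite /dot mulr_sumr; apply: eq_bigr => i _; rewrite mxE mulrA.
Qed.

Lemma dotC (R : realType) (u v : 'rV[R]_2) : dot u v = dot v u.
Proof. by apply: eq_bigr => i _; rewrite mulrC. Qed.

Lemma dotZr (R : realType) (a : R) (u v : 'rV[R]_2) :
  dot u (a *: v) = a * dot u v.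
Proof. by rewrite dotC dotZl dotC. Qed.

Lemma enormZ (R : realType) (a : R) (u : 'rV[R]_2) :
  enorm (a *: u) = `|a| * enorm u.
Proof.
by rewrite /enorm dotZl dotZr mulrA -expr2 sqrtrM ?sqr_ge0// sqrtr_sqr.
Qed.

Definition unit_dir (R : realType) (th : R) : 'rV[R]_2 :=
  \row_i (if i == 0 then cos th else sin th).

Lemma dot_unit_dir (R : realType) (s t : R) :
  dot (unit_dir s) (unit_dir t) = cos (t - s).
Proof.
rewrite /dot !big_ord_recl big_ord0 !mxE /= cosB; ring.
Qed.

Lemma enorm_unit_dir (R : realType) (t : R) : enorm (unit_dir t) = 1.
Proof. by rewrite /enorm dot_unit_dir subrr cos0 sqrtr1. Qed.

Lemma unit_dir_neq0 (R : realType) (t : R) : unit_dir t != 0.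
Proof.
apply/eqP => h; have := enorm_unit_dir t.
rewrite h -(scale0r (0 : 'rV[R]_2)) enormZ normr0 mul0r => /eqP.
by rewrite eq_sym oner_eq0.
Qed.

(** The angle at [y] uses the reversed first edge [x - y], so the turn by [pi - al] contributes
    [- cos (pi - al) = cos al]. *)
Lemma angle_turn (R : realType) (x y z : 'rV[R]_2) (r s t al : R) :
  0 < r -> 0 < s -> 0 <= al <= pi ->
  y - x = r *: unit_dir t -> z - y = s *: unit_dir (t + (pi - al)) ->
  angle x y z = al.
Proof.
move=> r0 s0 al0pi hxy hyz.
have hx : x - y = (- r) *: unit_dir t by rewrite scaleNr -hxy opprB.
rewrite /angle hx hyz !enormZ !enorm_unit_dir !mulr1 dotZl dotZr dot_unit_dir.
rewrite normrN !gtr0_norm// addrAC subrr add0r addrC cosDpi cosN.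
have -> : - r * (s * - cos al) / (r * s) = cos al by field; rewrite !gt_eqF.
by rewrite cosK// in_itv.
Qed.

(** Cramer's rule: [sin (t - s)] is the determinant of [unit_dir s] and [unit_dir t]. *)
Lemma unit_dir_coord (R : realType) (s t u : R) : sin (t - s) != 0 ->
  unit_dir u = (sin (t - u) / sin (t - s)) *: unit_dir s +
               (sin (u - s) / sin (t - s)) *: unit_dir t.
Proof.
move=> h; apply/rowP => i; rewrite !mxE.
rewrite !sinB in h *.
case: ifP => _; field: (cos2Dsin2 s) (cos2Dsin2 t) => //.
Qed.

(* [chain_point n i t] is the vertex x_i when the parameter of its block
   {x_(2j+1), x_(2j+2)} is [t < n]. The vertices x_(2j) and x_(2j+1) lie on the
   same line; its direction [d (2j)] is [a (2j) *: d (2j+1) + b (2j) *: d (2j+2)],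
   so projecting along [d (2j+1)] scales the parameter by [b (2j)]. *)
Section Chain.
Context (R : realFieldType) (V : lmodType R) (d : nat -> V) (a b : nat -> R).

(** The value 0 at [j = 0] makes the vertex of index 0 the origin for every parameter. *)
Definition line_scale (j : nat) : R := if j is j'.+1 then b j'.*2 else 0.

(** Both offsets grow with [n] so as to exceed every [line_scale j' * t] and every [a j'.*2 * t]
    with [t < n]; this keeps the edges positively oriented. *)
Fixpoint line_base (n j : nat) : V :=
  if j is j'.+1 then
    line_base n j' + (`|line_scale j'| * n%:R + 1) *: d j'.*2
                   + (`|a j'.*2| * n%:R + 1) *: d j'.*2.+1
  else 0.

Definition chain_point (n i t : nat) : V :=
  line_base n i./2 +
  (if odd i then (`|line_scale i./2| * n%:R + 1 + t%:R) *: d i.-1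
   else (line_scale i./2 * t%:R) *: d i).

Lemma chain_point0 n t : chain_point n 0 t = 0.
Proof. by rewrite /chain_point /= mul0r scale0r addr0. Qed.

Lemma chain_point_inj n i : odd i -> d i.-1 != 0 -> injective (chain_point n i).
Proof.
move=> oi di t s; rewrite /chain_point oi => /addrI /eqP.
rewrite -subr_eq0 -scalerBl scaler_eq0 (negPf di) orbF subr_eq0.
by move=> /eqP/addrI/eqP; rewrite eqr_nat => /eqP.
Qed.

Lemma normM_nat_gt (c : R) (n t : nat) :
  (t < n)%N -> c * t%:R < `|c| * n%:R + 1.
Proof.
move=> tn; apply: (@le_lt_trans _ _ (`|c| * n%:R)); last by rewrite ltrDl.
apply: (le_trans (ler_norm _)); rewrite normrM normr_nat.
by rewrite ler_wpM2l// ler_nat ltnW.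
Qed.

(** An edge from an odd vertex stays inside one block, hence [s = t] there; an edge from an even
    vertex runs along a line, and the two parameters are independent. *)
Lemma chain_step n i t s :
  (forall i, d i = a i *: d i.+1 + b i *: d i.+2) ->
  (t < n)%N -> (s < n)%N -> (odd i -> s = t) ->
  exists2 r, 0 < r & chain_point n i.+1 s - chain_point n i t = r *: d i.
Proof.
move=> hd tn sn; rewrite -[i]odd_double_half; set j := i./2.
case: (odd i) => st.
- rewrite add1n in st *.
  have {st}-> : s = t by apply: st; rewrite /= odd_double.
  exists (`|a j.*2| * n%:R + 1 - a j.*2 * t%:R).
    by rewrite subr_gt0 normM_nat_gt.
  rewrite /chain_point /= odd_double /= uphalf_double !doubleK /=.
  (* The relation [hd] is solved for the [d j.*2.+2] term: its [d j.*2] part cancels against the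
     free vertex, leaving a multiple of [d j.*2.+1]. *)
  have -> : (b j.*2 * t%:R) *: d j.*2.+2
          = t%:R *: d j.*2 - (t%:R * a j.*2) *: d j.*2.+1.
    by rewrite [d j.*2]hd scalerDr !scalerA addrAC subrr add0r mulrC.
  rewrite (scalerDl _ (_ + 1) t%:R) (scalerBl (_ + 1)) [a _ * t%:R]mulrC.
  set u := t%:R *: d _; set v := (t%:R * _) *: _; set z := (_ + 1) *: d _.+1.
  rewrite -[u - v]addrC addrA -[_ + z + _]addrA [z + _]addrC.
  by rewrite [X in _ - X]addrA [_ + _ + u]addrAC [LHS]addrAC subrr add0r.
- rewrite add0n.
  exists (`|line_scale j| * n%:R + 1 + s%:R - line_scale j * t%:R).
    by rewrite addrAC ltr_pwDl ?subr_gt0 ?normM_nat_gt.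
  rewrite /chain_point /= odd_double /= uphalf_double !doubleK /=.
  by rewrite opprD addrACA subrr add0r -scalerBl.
Qed.
End Chain.

Lemma finite_tuples_in (T : choiceType) (m : nat) (F : {fset T}) :
  finite_set [set x : m.-tuple T | forall i : 'I_m, tnth x i \in F].
Proof.
apply: (@sub_finite_set _ _
  [set map_tuple (@fsval T F) y | y in [set: m.-tuple F]]).
- move=> x hx; exists [tuple [` hx i]%fset | i < m] => //.
  by apply: eq_from_tnth => i; rewrite tnth_map tnth_mktuple.
- exact: finite_image.
Qed.

Lemma leq_card_fset_set (T : finType) (K : choiceType) (A : set K) (f : T -> K) :
  finite_set A -> injective f -> (forall x, A (f x)) ->
  (#|T| <= #|` fset_set A|)%N.
Proof.
move=> finA injf hf.
have -> : #|T| = #|` [fset f x | x in T]%fset| by rewrite card_imfset //= cardE.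
apply: fsubset_leq_card; apply/fsubsetP => _ /imfsetP[x _ ->].
by rewrite in_fset_set// inE.
Qed.

Lemma finite_angle_chains (R : realType) (k : nat) (alpha : 'I_k -> R)
  (E : {fset 'rV[R]_2}) : finite_set (angle_chains alpha E).
Proof.
(* The origin is adjoined because the first vertex need not lie in [E]. *)
apply: sub_finite_set (finite_tuples_in k.+2 (0 |` E)%fset).
move=> x [x0 xE _] [[|i] hi]; rewrite (tnth_nth 0) /= in_fset1U.
  by rewrite x0 eqxx.
by rewrite xE ?orbT.
Qed.

Theorem theorem2p8 (R : realType) (k : nat) (alpha : 'I_k -> R)
    (hk : (1 <= k)%N) (halpha : forall j : 'I_k, 0 < alpha j < pi) :
  exists E : nat -> {fset 'rV[R]_2},
    asymp_eq (fun n : nat => #|` E n|%:R : R) (fun n : nat => n%:R : R) /\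
    asymp_ge (fun n : nat => (num_angle_chains alpha (E n))%:R : R)
           (fun n : nat => (n ^ (k %/ 2 + 1))%:R : R).
Proof.
(* Angles beyond the first [k] get a filler value in [(0, pi)], so that directions exist at all
   indices and consecutive ones are never parallel. *)
pose be i : R := if insub i is Some j then alpha j else pi / 2.
have be0pi i : 0 < be i < pi.
  by rewrite /be; case: insub => [j|]; [exact: halpha|have := pi_gt0 R; lra].
pose th i : R := \sum_(0 <= l < i) (pi - be l).
have thS i : th i.+1 = th i + (pi - be i) by rewrite /th big_nat_recr.
pose d i := unit_dir (th i).
have [a [b hd]] : exists a b : nat -> R,
    forall i, d i = a i *: d i.+1 + b i *: d i.+2.
  exists (fun i => sin (th i.+2 - th i) / sin (th i.+2 - th i.+1)).
  exists (fun i => sin (th i - th i.+1) / sin (th i.+2 - th i.+1)) => i.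
  apply: unit_dir_coord; rewrite thS addrAC subrr add0r.
  by rewrite gt_eqF// sin_gt0_pi//; have := be0pi i.+1; lra.
pose P := chain_point d a b.
have stepP := fun n i t s => @chain_step R _ d a b n i t s hd.
pose E n : {fset 'rV[R]_2} :=
  [fset P n p.1.+1 p.2 | p : 'I_k.+1 * 'I_n in predT]%fset.
have memE n i t : (i < k.+1)%N -> (t < n)%N -> P n i.+1 t \in E n.
  by move=> ik tn; apply/imfsetP; exists (Ordinal ik, Ordinal tn).
exists E; split; [split|].
- exists k.+1%:R, 0%N; split => // n _.
  rewrite -natrM ler_nat.
  apply: leq_trans (leq_imfset_card _ _ _) _ => /=.
  by rewrite -cardE card_prod !card_ord.
(* The positions of the vertex of index 1 alone are [n] distinct points. *)
- exists 1, 0%N; split => // n _; rewrite mul1r ler_nat.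
  rewrite -{1}[n]card_ord -(set_fsetK (E n)).
  apply: (@leq_card_fset_set _ _ _ (fun t : 'I_n => P n 1 t)) => //.
    by move=> t s /chain_point_inj/val_inj; apply => //; exact: unit_dir_neq0.
  by move=> t /=; exact: memE.
exists 1, 0%N; split => // n n0; rewrite mul1r ler_nat divn2 addn1.
(* The block of vertex [i]: indices [2j+1] and [2j+2] both give [j]. Index 0 also gives 0,
   harmlessly, since that vertex is always the origin. *)
pose idx i : 'I_k./2.+1 := inord (i.-1)./2.
pose x (f : {ffun 'I_k./2.+1 -> 'I_n}) : k.+2.-tuple 'rV[R]_2 :=
  [tuple P n i (f (idx i)) | i < k.+2].
have xE f i : (i < k.+2)%N -> (x f)`_i = P n i (f (idx i)).
  by move=> ik; rewrite -[i]/(val (Ordinal ik)) -tnth_nth tnth_mktuple.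
have -> : (n ^ k./2.+1 = #|{ffun 'I_k./2.+1 -> 'I_n}|)%N.
  by rewrite card_ffun !card_ord.
apply: (@leq_card_fset_set _ _ _ x); first exact: finite_angle_chains.
(* The value [f j] is read off from the free vertex of index [2j+1], which is within range because
   [j <= k./2]. *)
- move=> f g fg; apply/ffunP => j.
  have jk : (j.*2.+1 < k.+2)%N.
    by rewrite !ltnS -geq_half_double -ltnS ltn_ord.
  have := xE f _ jk; rewrite fg xE// => /chain_point_inj.
  rewrite /idx /= odd_double doubleK inord_val => h.
  by apply/esym/val_inj/h => //; exact: unit_dir_neq0.
move=> f.
have stepx i : (i < k.+1)%N ->
    exists2 r, 0 < r & (x f)`_i.+1 - (x f)`_i = r *: d i.
  move=> ik; rewrite !xE ?(leqW ik)//; apply: stepP => //.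
  by case: i ik => //= i ik oi; rewrite /idx /= uphalf_half (negPf oi).
have neqx i : (i < k.+1)%N -> (x f)`_i != (x f)`_i.+1.
  move=> ik; have [r r0 hr] := stepx _ ik.
  by rewrite eq_sym -subr_eq0 hr scaler_eq0 negb_or gt_eqF// unit_dir_neq0.
split.
- by rewrite xE// /P chain_point0.
- by move=> [|i]// /andP[_ ik]; rewrite xE// memE.
move=> j; have jk := ltn_ord j; split; [by apply: neqx; rewrite ltnW|exact: neqx|].
have [r r0 hr] := stepx j (ltnW jk).
have [s s0 hs] := stepx j.+1 jk.
have bej : be j = alpha j by rewrite /be valK.
apply: (angle_turn r0 s0 _ hr); last by rewrite hs /d thS bej.
by have /andP[? ?] := halpha j; rewrite !ltW.
Qed.
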